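(* Let $f,g:\mathbb R^N\to\mathbb R\cup\{+\infty\}$ be proper lsc convex with $\mathrm{ri}(\mathrm{dom}f)\cap\mathrm{ri}(\mathrm{dom}g)\neq\emptyset$ and $\mathrm{Argmin}(f+g)\neq\emptyset$. Let $\gamma>0$, $\tau_k\in]0,2[$ with $\sum_k\tau_k(2-\tau_k)=+\infty$, and consider the Douglas–Rachford iteration $v_{k+1}=\mathrm{prox}_{\gamma f}(2x_k-z_k)$, $z_{k+1}=z_k+\tau_k(v_{k+1}-x_k)$, $x_{k+1}=\mathrm{prox}_{\gamma g}(z_{k+1})$ (with $x_0=\mathrm{prox}_{\gamma g}(z_0)$). Then $z_k\to z^\star$, where $x^\star=\mathrm{prox}_{\gamma g}(z^\star)\in\mathrm{Argmin}(f+g)$, and $x_k\to x^\star$, $v_k\to x^\star$. Let $u^\star=(z^\star-x^\star)/\gamma$. (i) If $g$ is mirror-stratifiable with respect to $(\mathcal S^g,\mathcal S^{g^*})$, then for $k$ large enough $M^g_{x^\star}\le M^g_{x_k}\le J_{g^*}(M^{g^*}_{u^\star})$. (ii) If $f$ is mirror-stratifiable with respect to $(\mathcal S^f,\mathcal S^{f^*})$, then for $k$ large enough $M^f_{x^\star}\le M^f_{v_k}\le J_{f^*}(M^{f^*}_{-u^\star})$.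
   Context: $\mathrm{prox}_{\gamma h}(x)=\mathrm{argmin}_z\frac12\|z-x\|^2+\gamma h(z)$; $\mathrm{ri}$ = relative interior. A stratification of a set $D$ is a finite partition $\mathcal S$ of $D$ into nonempty sets called strata such that for any strata $M,M'$, $M\cap\mathrm{cl}(M')\neq\emptyset$ implies $M\subset\mathrm{cl}(M')$; ordered by $M\le M'$ iff $M\subset\mathrm{cl}(M')$. $M^h_x$ denotes the stratum of $\mathcal S^h$ containing $x$ (similarly for dual strata). For proper lsc convex $R$ with conjugate $R^*$, $J_R(S)=\bigcup_{x\in S}\mathrm{ri}(\partial R(x))$, $J_{R^*}$ analogously. $R$ is mirror-stratifiable with respect to a stratification $\mathcal S$ of $\mathrm{dom}(\partial R)$ and a stratification $\mathcal S^*$ of $\mathrm{dom}(\partial R^* )$ if (i) $J_R$ maps $\mathcal S$ bijectively onto $\mathcal S^*$ with inverse $J_{R^*}$, i.e. for all $M\in\mathcal S$, $M^*\in\mathcal S^*$: $M^*=J_R(M)\iff J_{R^*}(M^* )=M$; and (ii) for all $M,M'\in\mathcal S$: $M\le M'\iff J_R(M)\ge J_R(M')$. *)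

(* Defs.v *)
From Stdlib Require Import Reals Lra List ClassicalEpsilon.
Require Stdlib.Vectors.Fin.
Open Scope R_scope.

Definition vec (N : nat) : Type := Fin.t N -> R.

Fixpoint fsum (n : nat) : (Fin.t n -> R) -> R :=
  match n with
  | O => fun _ => 0
  | S m => fun f => f (@Fin.F1 m) + fsum m (fun i => f (Fin.FS i))
  end.

Definition vzero {N} : vec N := fun _ => 0.
Definition vadd {N} (a b : vec N) : vec N := fun i => a i + b i.
Definition vopp {N} (a : vec N) : vec N := fun i => - a i.
Definition vsub {N} (a b : vec N) : vec N := fun i => a i - b i.
Definition vscal {N} (c : R) (a : vec N) : vec N := fun i => c * a i.
Definition inner {N} (a b : vec N) : R := fsum N (fun i => a i * b i).
Definition norm {N} (a : vec N) : R := sqrt (inner a a).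

Definition conv {N} (s : nat -> vec N) (l : vec N) : Prop :=
  forall e, 0 < e -> exists K, forall k, (K <= k)%nat -> norm (vsub (s k) l) < e.

Definition set (N : nat) := vec N -> Prop.
Definition subset {N} (A B : set N) : Prop := forall x, A x -> B x.
Definition set_eq {N} (A B : set N) : Prop := forall x, A x <-> B x.
Definition cl {N} (A : set N) : set N :=
  fun x => forall e, 0 < e -> exists y, A y /\ norm (vsub y x) < e.
Definition aff {N} (A : set N) : set N :=
  fun y => exists l : list (R * vec N),
    Forall (fun p => A (snd p)) l /\
    fold_right (fun p s => fst p + s) 0 l = 1 /\
    y = fold_right (fun p acc => vadd (vscal (fst p) (snd p)) acc) vzero l.
Definition ri {N} (A : set N) : set N :=
  fun x => A x /\ exists e, 0 < e /\
    forall y, aff A y -> norm (vsub y x) < e -> A y.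

(* ---------- extended reals R ∪ {+oo} : None = +oo ---------- *)
Definition ext := option R.
Definition ele (a b : ext) : Prop :=
  match b with
  | None => True
  | Some b' => match a with None => False | Some a' => a' <= b' end
  end.
Definition eadd (a b : ext) : ext :=
  match a, b with Some a', Some b' => Some (a' + b') | _, _ => None end.
Definition escal (c : R) (a : ext) : ext :=
  match a with Some a' => Some (c * a') | None => None end.
Definition rlt (c : R) (a : ext) : Prop :=
  match a with None => True | Some a' => c < a' end.

Definition dom {N} (f : vec N -> ext) : set N := fun x => f x <> None.
Definition proper {N} (f : vec N -> ext) : Prop := exists x, f x <> None.
Definition convex {N} (f : vec N -> ext) : Prop :=
  forall x y fx fy t, 0 < t < 1 -> f x = Some fx -> f y = Some fy ->
    ele (f (vadd (vscal t x) (vscal (1 - t) y))) (Some (t * fx + (1 - t) * fy)).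
Definition lsc {N} (f : vec N -> ext) : Prop :=
  forall x c, rlt c (f x) ->
    exists d, 0 < d /\ forall y, norm (vsub y x) < d -> rlt c (f y).

Definition subdiff {N} (f : vec N -> ext) (x : vec N) : set N :=
  fun u => exists fx, f x = Some fx /\
    forall y, ele (Some (fx + inner u (vsub y x))) (f y).

Definition is_conj {N} (f : vec N -> ext) (u : vec N) (c : ext) : Prop :=
  match c with
  | Some a => is_lub (fun r => exists x fx, f x = Some fx /\ r = inner u x - fx) a
  | None => forall M, exists x fx, f x = Some fx /\ M < inner u x - fx
  end.
Definition conjf {N} (f : vec N -> ext) : vec N -> ext :=
  fun u => epsilon (inhabits None) (is_conj f u).

Definition is_prox {N} (gamma : R) (h : vec N -> ext) (x p : vec N) : Prop :=
  h p <> None /\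
  forall z, ele (eadd (Some (/2 * (norm (vsub p x))^2)) (escal gamma (h p)))
                (eadd (Some (/2 * (norm (vsub z x))^2)) (escal gamma (h z))).

Definition argmin_sum {N} (f g : vec N -> ext) (x : vec N) : Prop :=
  exists a, eadd (f x) (g x) = Some a /\ forall y, ele (Some a) (eadd (f y) (g y)).

Definition stratification {N} (D : set N) (S : list (set N)) : Prop :=
  (forall M, In M S -> exists x, M x) /\
  (forall i j Mi Mj, nth_error S i = Some Mi -> nth_error S j = Some Mj ->
      i <> j -> forall x, Mi x -> Mj x -> False) /\
  (forall x, D x <-> exists M, In M S /\ M x) /\
  (forall M M', In M S -> In M' S -> (exists x, M x /\ cl M' x) -> subset M (cl M')).

Definition strat_le {N} (M M' : set N) : Prop := subset M (cl M').

Definition stratum {N} (S : list (set N)) (x : vec N) (M : set N) : Prop :=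
  In M S /\ M x.

Definition J {N} (Rf : vec N -> ext) (A : set N) : set N :=
  fun u => exists x, A x /\ ri (subdiff Rf x) u.

Definition mirror_strat {N} (Rf : vec N -> ext) (S Ss : list (set N)) : Prop :=
  stratification (fun x => exists u, subdiff Rf x u) S /\
  stratification (fun u => exists x, subdiff (conjf Rf) u x) Ss /\
  (forall M, In M S -> exists Ms, In Ms Ss /\ set_eq Ms (J Rf M)) /\
  (forall Ms, In Ms Ss -> exists M, In M S /\ set_eq M (J (conjf Rf) Ms)) /\
  (forall M Ms, In M S -> In Ms Ss ->
      (set_eq Ms (J Rf M) <-> set_eq (J (conjf Rf) Ms) M)) /\
  (forall M M', In M S -> In M' S ->
      (strat_le M M' <-> strat_le (J Rf M') (J Rf M))).

(* Main.v *)
(** A minimiser of f + g splits as 0 = (-u) + u with u a subgradient of g and -u one of f,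
    by a finite-dimensional Hahn-Banach argument under the relative interior condition; this
    gives a fixed point of the Douglas-Rachford operator.  The residual operator of the
    iteration is firmly nonexpansive, so the iterates are Fejer monotone with respect to its
    zeros and the residuals have nonincreasing norm; divergence of sum tau_k (2 - tau_k) then
    drives the residuals to 0.  Cluster points are zeros because the graphs of the
    subdifferentials are closed, whence convergence.

    For the strata, a convergent sequence eventually visits only strata whose closure contains
    the limit.  On the primal side this gives the lower bound.  On the dual side, the
    subgradients u_k at x_k lie in the closure of ri (subdiff g x_k), hence in that of
    J_g (M_{x_k}), so M*_{u*} <= J_g (M_{x_k}) eventually, and the order-reversing bijection
    turns this into the upper bound. *)
Require Import Defs.
From Stdlib Require Import Reals Lra Lia List FunctionalExtensionality
  ClassicalEpsilon FinFun.
Open Scope R_scope.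

Ltac vec_ext := let i := fresh "i" in
  extensionality i; unfold vsub, vadd, vscal, vopp, vzero.
Ltac vec_ring := vec_ext; ring.

Lemma exists_pos_mul_lt (a e : R) : 0 <= a -> 0 < e -> exists t, 0 < t /\ t * a < e.
Proof.
  intros a_ge0 e_pos. exists (e / (a + 1)).
  assert (t_pos : 0 < e / (a + 1)) by (apply Rdiv_lt_0_compat; lra).
  split; [exact t_pos|].
  assert (e / (a + 1) * (a + 1) = e) by (field; lra). lra.
Qed.

Lemma exists_pos_mul_lt_both (a b d e : R) : 0 <= a -> 0 <= b -> 0 < d -> 0 < e ->
  exists t, 0 < t /\ t * a < d /\ t * b < e.
Proof.
  intros a_ge0 b_ge0 d_pos e_pos.
  destruct (exists_pos_mul_lt a d a_ge0 d_pos) as [r [r_pos r_lt]].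
  destruct (exists_pos_mul_lt b e b_ge0 e_pos) as [s [s_pos s_lt]].
  exists (Rmin r s). pose proof (Rmin_l r s). pose proof (Rmin_r r s).
  split; [now apply Rmin_glb_lt|]. split; nra.
Qed.

Lemma ge0_of_small_perturbations (a b : R) :
  (forall t, 0 < t < 1 -> 0 <= a + t * b) -> 0 <= a.
Proof.
  intros perturbed_ge0. apply Rle_plus_epsilon. intros e e_pos.
  destruct (exists_pos_mul_lt_both 1 (Rabs b) 1 e) as [t [t_pos [t_lt1 tb_lt]]];
    [lra|apply Rabs_pos|lra|exact e_pos|].
  specialize (perturbed_ge0 t ltac:(lra)). pose proof (Rle_abs b). nra.
Qed.

(** * Euclidean space *)

Lemma fsum_ext (n : nat) (a b : Fin.t n -> R) :
  (forall i, a i = b i) -> fsum n a = fsum n b.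
Proof. intros a_eq_b. f_equal. now extensionality i. Qed.

Lemma fsum_plus (n : nat) (a b : Fin.t n -> R) :
  fsum n (fun i => a i + b i) = fsum n a + fsum n b.
Proof. induction n as [|n IH]; simpl; [|rewrite IH]; lra. Qed.

Lemma fsum_scal (n : nat) (c : R) (a : Fin.t n -> R) :
  fsum n (fun i => c * a i) = c * fsum n a.
Proof. induction n as [|n IH]; simpl; [|rewrite IH]; lra. Qed.

Section InnerProduct.

Context {N : nat}.
Implicit Types a b c : vec N.

Lemma inner_comm a b : inner a b = inner b a.
Proof. apply fsum_ext. intros i. ring. Qed.

Lemma inner_vadd_l a b c : inner (vadd a b) c = inner a c + inner b c.
Proof.
  unfold inner. rewrite <- fsum_plus. apply fsum_ext. intros i. unfold vadd. ring.
Qed.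

Lemma inner_vscal_l t a c : inner (vscal t a) c = t * inner a c.
Proof.
  unfold inner. rewrite <- fsum_scal. apply fsum_ext. intros i. unfold vscal. ring.
Qed.

Lemma inner_vsub_l a b c : inner (vsub a b) c = inner a c - inner b c.
Proof.
  replace (vsub a b) with (vadd a (vscal (-1) b)) by vec_ring.
  rewrite inner_vadd_l, inner_vscal_l. ring.
Qed.

Lemma inner_vopp_l a c : inner (vopp a) c = - inner a c.
Proof.
  replace (vopp a) with (vscal (-1) a) by vec_ring. rewrite inner_vscal_l. ring.
Qed.

Lemma inner_vzero_l c : inner vzero c = 0.
Proof.
  replace vzero with (vscal 0 c) by vec_ring. rewrite inner_vscal_l. ring.
Qed.

Lemma inner_vadd_r a b c : inner c (vadd a b) = inner c a + inner c b.
Proof. now rewrite !(inner_comm c), inner_vadd_l. Qed.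

Lemma inner_vscal_r t a c : inner c (vscal t a) = t * inner c a.
Proof. now rewrite !(inner_comm c), inner_vscal_l. Qed.

Lemma inner_vsub_r a b c : inner c (vsub a b) = inner c a - inner c b.
Proof. now rewrite !(inner_comm c), inner_vsub_l. Qed.

Lemma inner_vopp_r a c : inner c (vopp a) = - inner c a.
Proof. now rewrite !(inner_comm c), inner_vopp_l. Qed.

Lemma inner_vzero_r c : inner c vzero = 0.
Proof. now rewrite inner_comm, inner_vzero_l. Qed.

End InnerProduct.

#[local] Hint Rewrite @inner_vadd_l @inner_vsub_l @inner_vscal_l @inner_vopp_l @inner_vzero_l
  @inner_vadd_r @inner_vsub_r @inner_vscal_r @inner_vopp_r @inner_vzero_r : inner.

Lemma inner_self_ge0 {N : nat} (a : vec N) : 0 <= inner a a.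
Proof.
  induction N as [|N IH]; [apply Rle_refl|].
  specialize (IH (fun i => a (Fin.FS i))). unfold inner in *. simpl. nra.
Qed.

Lemma coord_sqr_le_inner {N : nat} (a : vec N) (i : Fin.t N) : a i * a i <= inner a a.
Proof.
  induction i as [n|n i IH].
  - pose proof (inner_self_ge0 (fun j => a (Fin.FS j))). unfold inner in *. simpl. lra.
  - specialize (IH (fun j => a (Fin.FS j))). unfold inner in *. simpl in *. nra.
Qed.

Section Norm.

Context {N : nat}.
Implicit Types a b c : vec N.

Lemma norm_ge0 a : 0 <= norm a.
Proof. apply sqrt_pos. Qed.

Lemma norm_sqr a : norm a * norm a = inner a a.
Proof. apply sqrt_sqrt, inner_self_ge0. Qed.

Lemma norm_vzero : norm (@vzero N) = 0.
Proof. unfold norm. now rewrite inner_vzero_l, sqrt_0. Qed.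

Lemma norm_le_of_sqr a r : 0 <= r -> inner a a <= r * r -> norm a <= r.
Proof. rewrite <- norm_sqr. pose proof (norm_ge0 a). nra. Qed.

Lemma norm_lt_of_sqr a r : 0 <= r -> inner a a < r * r -> norm a < r.
Proof. rewrite <- norm_sqr. pose proof (norm_ge0 a). nra. Qed.

Lemma coord_le_norm a i : Rabs (a i) <= norm a.
Proof.
  pose proof (coord_sqr_le_inner a i) as coord_le. rewrite <- norm_sqr in coord_le.
  pose proof (norm_ge0 a). apply Rabs_le. split; nra.
Qed.

Lemma inner_self_eq0 a : inner a a = 0 -> a = vzero.
Proof.
  intros a_null. extensionality i. pose proof (coord_sqr_le_inner a i). unfold vzero. nra.
Qed.

Lemma cauchy_schwarz_sqr a b : inner a b * inner a b <= inner a a * inner b b.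
Proof.
  destruct (Req_dec (inner b b) 0) as [b_null|b_nonnull].
  - rewrite (inner_self_eq0 b b_null). autorewrite with inner. lra.
  - pose proof (inner_self_ge0 b).
    pose proof (inner_self_ge0 (vsub (vscal (inner b b) a) (vscal (inner a b) b))) as defect.
    autorewrite with inner in defect. rewrite (inner_comm b a) in defect.
    assert (0 <= inner b b * (inner a a * inner b b - inner a b * inner a b)) by lra.
    nra.
Qed.

Lemma cauchy_schwarz a b : Rabs (inner a b) <= norm a * norm b.
Proof.
  pose proof (cauchy_schwarz_sqr a b) as sqr_le. rewrite <- !norm_sqr in sqr_le.
  pose proof (Rmult_le_pos _ _ (norm_ge0 a) (norm_ge0 b)).
  apply Rabs_le. split; nra.
Qed.

Lemma inner_le_norm a b : inner a b <= norm a * norm b.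
Proof. eapply Rle_trans; [apply Rle_abs|apply cauchy_schwarz]. Qed.

Lemma norm_triangle a b : norm (vadd a b) <= norm a + norm b.
Proof.
  pose proof (norm_ge0 a). pose proof (norm_ge0 b). apply norm_le_of_sqr; [lra|].
  autorewrite with inner. rewrite (inner_comm b a).
  pose proof (inner_le_norm a b). pose proof (norm_sqr a). pose proof (norm_sqr b). nra.
Qed.

Lemma norm_vsub_triangle a b c : norm (vsub a c) <= norm (vsub a b) + norm (vsub b c).
Proof.
  replace (vsub a c) with (vadd (vsub a b) (vsub b c)) by vec_ring. apply norm_triangle.
Qed.

Lemma norm_le_vsub a b : norm a <= norm (vsub a b) + norm b.
Proof. replace a with (vadd (vsub a b) b) at 1 by vec_ring. apply norm_triangle. Qed.

Lemma norm_vscal t a : norm (vscal t a) = Rabs t * norm a.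
Proof.
  unfold norm. autorewrite with inner.
  rewrite <- sqrt_Rsqr_abs, <- sqrt_mult_alt by apply Rle_0_sqr.
  f_equal. unfold Rsqr. ring.
Qed.

End Norm.

(** * Linear forms *)

Definition linear_form {N : nat} (phi : vec N -> R) : Prop :=
  (forall a b, phi (vadd a b) = phi a + phi b) /\
  (forall t a, phi (vscal t a) = t * phi a).

Lemma linear_form_coord {N : nat} (i : Fin.t N) : linear_form (fun w => w i).
Proof. split; reflexivity. Qed.

Lemma linear_form_vzero {N : nat} (phi : vec N -> R) : linear_form phi -> phi vzero = 0.
Proof.
  intros [_ phi_scal].
  replace (@vzero N) with (@vscal N 0 vzero) by vec_ring. rewrite phi_scal. ring.
Qed.

Lemma linear_form_vopp {N : nat} (phi : vec N -> R) (a : vec N) :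
  linear_form phi -> phi (vopp a) = - phi a.
Proof.
  intros [_ phi_scal].
  replace (vopp a) with (vscal (-1) a) by vec_ring. rewrite phi_scal. ring.
Qed.

Lemma linear_form_add_mul {N : nat} (phi psi : vec N -> R) (c : R) :
  linear_form phi -> linear_form psi -> linear_form (fun w => phi w + c * psi w).
Proof.
  intros [phi_add phi_scal] [psi_add psi_scal]. split; intros.
  - rewrite phi_add, psi_add. ring.
  - rewrite phi_scal, psi_scal. ring.
Qed.

Definition vcons {n : nat} (c : R) (a : vec n) : vec (S n) :=
  fun i => Fin.caseS' i (fun _ => R) c a.

Lemma vcons_vadd (n : nat) (c d : R) (a b : vec n) :
  vcons (c + d) (vadd a b) = vadd (vcons c a) (vcons d b).
Proof. extensionality i. now apply (Fin.caseS' i). Qed.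

Lemma vcons_vscal (n : nat) (t c : R) (a : vec n) :
  vcons (t * c) (vscal t a) = vscal t (vcons c a).
Proof. extensionality i. now apply (Fin.caseS' i). Qed.

Lemma vcons_eta (n : nat) (a : vec (S n)) :
  a = vcons (a Fin.F1) (fun i => a (Fin.FS i)).
Proof. extensionality i. now apply (Fin.caseS' i). Qed.

Lemma linear_form_inner {N : nat} (phi : vec N -> R) :
  linear_form phi -> exists u, forall w, phi w = inner u w.
Proof.
  revert phi. induction N as [|n IH]; intros phi phi_lin.
  - exists vzero. intros w. replace w with (@vzero 0) by (extensionality i; inversion i).
    now rewrite linear_form_vzero, inner_vzero_l.
  - destruct phi_lin as [phi_add phi_scal].
    destruct (IH (fun w => phi (vcons 0 w))) as [u phi_tail].
    { split; intros.
      - now rewrite <- phi_add, <- vcons_vadd, Rplus_0_r.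
      - now rewrite <- phi_scal, <- vcons_vscal, Rmult_0_r. }
    exists (vcons (phi (vcons 1 vzero)) u). intros w. rewrite (vcons_eta n w) at 1.
    set (tail := fun i => w (Fin.FS i)).
    replace (vcons (w Fin.F1) tail)
      with (vadd (vscal (w Fin.F1) (vcons 1 vzero)) (vcons 0 tail)).
    + rewrite phi_add, phi_scal, phi_tail. unfold inner. simpl. unfold tail. ring.
    + rewrite <- vcons_vscal, <- vcons_vadd, Rmult_1_r, Rplus_0_r. f_equal. vec_ring.
Qed.

Lemma linear_forms_bounded {N : nat} (phis : list (vec N -> R)) :
  Forall linear_form phis ->
  exists L, 0 < L /\ Forall (fun phi => forall w, Rabs (phi w) <= L * norm w) phis.
Proof.
  intros phis_lin. induction phis_lin as [|phi phis phi_lin _ [L [L_pos phis_le]]].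
  - exists 1. split; [lra|constructor].
  - destruct (linear_form_inner phi phi_lin) as [u phi_eq].
    pose proof (norm_ge0 u). exists (L + norm u). split; [lra|]. constructor.
    + intros w. rewrite phi_eq. pose proof (cauchy_schwarz u w). pose proof (norm_ge0 w). nra.
    + eapply Forall_impl; [|exact phis_le]. simpl. intros psi psi_le w.
      specialize (psi_le w). pose proof (norm_ge0 w). nra.
Qed.

(** * Convergence of vector sequences *)

Lemma Un_cv_const (c : R) : Un_cv (fun _ => c) c.
Proof. intros e e_pos. exists O. intros. now rewrite Rdist_eq. Qed.

Lemma fsum_cv (n : nat) (s : nat -> Fin.t n -> R) (l : Fin.t n -> R) :
  (forall i, Un_cv (fun k => s k i) (l i)) -> Un_cv (fun k => fsum n (s k)) (fsum n l).
Proof.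
  revert s l. induction n as [|n IH]; intros s l coord_cv; simpl.
  - apply Un_cv_const.
  - apply CV_plus; [apply coord_cv|]. apply (IH (fun k i => s k (Fin.FS i))).
    intros i. apply coord_cv.
Qed.

Lemma conv_of_sqr_cv {N : nat} (s : nat -> vec N) (l : vec N) :
  Un_cv (fun k => inner (vsub (s k) l) (vsub (s k) l)) 0 -> conv s l.
Proof.
  intros sqr_cv e e_pos. destruct (sqr_cv (e * e)) as [K sqr_small]; [nra|].
  exists K. intros k k_ge. apply norm_lt_of_sqr; [lra|].
  specialize (sqr_small k k_ge). unfold Rdist in sqr_small.
  apply Rabs_def2 in sqr_small. lra.
Qed.

Lemma conv_coord {N : nat} (s : nat -> vec N) (l : vec N) :
  conv s l <-> forall i, Un_cv (fun k => s k i) (l i).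
Proof.
  split.
  - intros s_conv i e e_pos. destruct (s_conv e e_pos) as [K close]. exists K.
    intros k k_ge. eapply Rle_lt_trans; [|apply (close k k_ge)].
    apply (coord_le_norm (vsub (s k) l) i).
  - intros coord_cv. apply conv_of_sqr_cv.
    replace 0 with (fsum N (fun i => (l i - l i) * (l i - l i))).
    + apply (fsum_cv N (fun k i => (s k i - l i) * (s k i - l i))). intros i.
      apply CV_mult; apply CV_minus; auto using Un_cv_const.
    + rewrite <- (inner_vzero_l (@vzero N)). apply fsum_ext. intros i. unfold vzero. ring.
Qed.

Section Conv.

Context {N : nat}.
Implicit Types (a b s : nat -> vec N) (la lb l : vec N).

Lemma conv_const l : conv (fun _ => l) l.
Proof. rewrite conv_coord. intros i. apply Un_cv_const. Qed.

Lemma conv_vsub a b la lb :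
  conv a la -> conv b lb -> conv (fun k => vsub (a k) (b k)) (vsub la lb).
Proof. rewrite !conv_coord. intros a_cv b_cv i. now apply CV_minus. Qed.

Lemma conv_vscal c a la : conv a la -> conv (fun k => vscal c (a k)) (vscal c la).
Proof. rewrite !conv_coord. intros a_cv i. apply CV_mult; auto using Un_cv_const. Qed.

Lemma inner_cv a b la lb :
  conv a la -> conv b lb -> Un_cv (fun k => inner (a k) (b k)) (inner la lb).
Proof.
  rewrite !conv_coord. intros a_cv b_cv. apply (fsum_cv N (fun k i => a k i * b k i)).
  intros i. now apply CV_mult.
Qed.

Lemma conv_bounded s l : conv s l -> exists B, forall k, norm (s k) <= B.
Proof.
  intros s_conv.
  destruct (maj_by_pos (fun k => inner (s k) (s k))) as [B [B_pos sqr_le]].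
  { exists (inner l l). now apply inner_cv. }
  exists (B + 1). intros k. apply norm_le_of_sqr; [lra|].
  pose proof (Rle_abs (inner (s k) (s k))). specialize (sqr_le k). nra.
Qed.

Lemma conv_shift s l : conv (fun k => s (S k)) l -> conv s l.
Proof.
  intros s_conv e e_pos. destruct (s_conv e e_pos) as [K close]. exists (S K).
  intros [|k] k_ge; [lia|]. apply close. lia.
Qed.

End Conv.

(* Not required to be increasing: for limits only phi n -> +oo matters. *)
Definition reindexing (phi : nat -> nat) : Prop := forall n, (n <= phi n)%nat.

Lemma reindexing_comp (phi psi : nat -> nat) :
  reindexing phi -> reindexing psi -> reindexing (fun n => phi (psi n)).
Proof. intros phi_ge psi_ge n. specialize (phi_ge (psi n)). specialize (psi_ge n). lia. Qed.

Lemma Un_cv_reindexing (s : nat -> R) (l : R) (phi : nat -> nat) :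
  reindexing phi -> Un_cv s l -> Un_cv (fun n => s (phi n)) l.
Proof.
  intros phi_ge s_cv e e_pos. destruct (s_cv e e_pos) as [K close]. exists K.
  intros n n_ge. apply close. specialize (phi_ge n). lia.
Qed.

Lemma conv_reindexing {N : nat} (s : nat -> vec N) (l : vec N) (phi : nat -> nat) :
  reindexing phi -> conv s l -> conv (fun n => s (phi n)) l.
Proof.
  rewrite !conv_coord. intros phi_ge s_cv i.
  now apply (Un_cv_reindexing (fun n => s n i)).
Qed.

Lemma ValAdh_reindexing (s : nat -> R) (l : R) :
  ValAdh s l -> exists phi, reindexing phi /\ Un_cv (fun n => s (phi n)) l.
Proof.
  intros s_adh.
  assert (close_term : forall n, exists p, (n <= p)%nat /\ Rabs (s p - l) < RinvN n).
  { intros n. apply (s_adh (disc l (RinvN n)) n). exists (RinvN n). now intros y. }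
  apply choice in close_term. destruct close_term as [phi close].
  exists phi. split; [intros n; apply close|]. intros e e_pos.
  destruct (RinvN_cv e_pos) as [K inv_small]. exists K. intros n n_ge.
  eapply Rlt_trans; [apply close|]. specialize (inv_small n n_ge).
  unfold Rdist in inv_small. apply Rabs_def2 in inv_small. lra.
Qed.

Lemma bounded_cv_reindexing (s : nat -> R) (B : R) : (forall n, Rabs (s n) <= B) ->
  exists l phi, reindexing phi /\ Un_cv (fun n => s (phi n)) l.
Proof.
  intros s_le. destruct (Bolzano_Weierstrass s (fun c => - B <= c <= B)) as [l l_adh].
  - apply compact_P3.
  - intros n. specialize (s_le n). pose proof (Rle_abs (s n)).
    pose proof (Rle_abs (- s n)) as opp_le. rewrite Rabs_Ropp in opp_le. lra.
  - exists l. now apply ValAdh_reindexing.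
Qed.

Lemma bounded_coords_cv_reindexing {N : nat} (s : nat -> vec N) (B : R)
  (coords : list (Fin.t N)) : (forall n, norm (s n) <= B) ->
  exists phi, reindexing phi /\
    forall i, In i coords -> exists l, Un_cv (fun n => s (phi n) i) l.
Proof.
  intros s_le. induction coords as [|i coords [phi [phi_ge coords_cv]]].
  - exists (fun n => n). split; [now intros n|]. intros i [].
  - destruct (bounded_cv_reindexing (fun n => s (phi n) i) B) as [li [psi [psi_ge i_cv]]].
    { intros n. eapply Rle_trans; [apply coord_le_norm|apply s_le]. }
    exists (fun n => phi (psi n)). split; [now apply reindexing_comp|].
    intros j [<-|j_in]; [now exists li|].
    destruct (coords_cv j j_in) as [lj j_cv]. exists lj.
    now apply (Un_cv_reindexing (fun n => s (phi n) j)).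
Qed.

Lemma bounded_conv_reindexing {N : nat} (s : nat -> vec N) (B : R) :
  (forall n, norm (s n) <= B) ->
  exists l phi, reindexing phi /\ conv (fun n => s (phi n)) l.
Proof.
  intros s_le. destruct (Fin_Finite N) as [coords coords_full].
  destruct (bounded_coords_cv_reindexing s B coords s_le) as [phi [phi_ge coords_cv]].
  destruct (choice (fun i l => Un_cv (fun n => s (phi n) i) l)) as [l l_cv].
  { intros i. apply coords_cv, coords_full. }
  exists l, phi. split; [exact phi_ge|]. now apply conv_coord.
Qed.

(** * Subdifferentials and proximal points *)

Definition monotone {N : nat} (A : vec N -> vec N -> Prop) : Prop :=
  forall x u y w, A x u -> A y w -> 0 <= inner (vsub u w) (vsub x y).

Definition closed_graph {N : nat} (A : vec N -> vec N -> Prop) : Prop :=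
  forall (xk uk : nat -> vec N) x u,
    conv xk x -> conv uk u -> (forall k, A (xk k) (uk k)) -> A x u.

(* p = (I + gamma A)^(-1) z. *)
Definition resolvent {N : nat} (gamma : R) (A : vec N -> vec N -> Prop) (z p : vec N) : Prop :=
  A p (vscal (/ gamma) (vsub z p)).

Definition convex_set {N : nat} (C : set N) : Prop :=
  forall a b t, 0 <= t <= 1 -> C a -> C b -> C (vadd (vscal t a) (vscal (1 - t) b)).

Lemma subdiff_monotone {N : nat} (f : vec N -> ext) : monotone (subdiff f).
Proof.
  intros x u y w [fx [f_x u_le]] [fy [f_y w_le]].
  specialize (u_le y). specialize (w_le x). rewrite f_y in u_le. rewrite f_x in w_le.
  simpl in *. autorewrite with inner in *. lra.
Qed.

Lemma subdiff_convex_set {N : nat} (f : vec N -> ext) (x : vec N) : convex_set (subdiff f x).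
Proof.
  intros a b t t_range [fx [f_x a_le]] [fx' [f_x' b_le]]. exists fx. split; [exact f_x|].
  intros y. specialize (a_le y). specialize (b_le y).
  rewrite f_x in f_x'. injection f_x' as <-.
  destruct (f y) as [fy|]; simpl in *; [|exact I].
  rewrite inner_vadd_l, !inner_vscal_l. nra.
Qed.

Lemma lsc_le_lim {N : nat} (f : vec N -> ext) (xk : nat -> vec N) (x : vec N)
  (bk : nat -> R) (b : R) : lsc f -> conv xk x -> Un_cv bk b ->
  (forall k, ele (f (xk k)) (Some (bk k))) -> ele (f x) (Some b).
Proof.
  intros f_lsc x_conv b_cv f_le. apply NNPP. intros not_le.
  assert (between : exists c, b < c /\ rlt c (f x)).
  { destruct (f x) as [fx|]; simpl in *.
    - exists ((b + fx) / 2). lra.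
    - exists (b + 1). split; [lra|exact I]. }
  destruct between as [c [b_lt c_lt]]. destruct (f_lsc x c c_lt) as [r [r_pos c_lt_near]].
  destruct (x_conv r r_pos) as [K1 x_close], (b_cv (c - b)) as [K2 b_close]; [lra|].
  set (k := max K1 K2).
  specialize (c_lt_near (xk k) (x_close k ltac:(unfold k; lia))).
  specialize (b_close k ltac:(unfold k; lia)). specialize (f_le k).
  unfold Rdist in b_close. apply Rabs_def2 in b_close.
  destruct (f (xk k)) as [fk|]; simpl in *; [lra|contradiction].
Qed.

Lemma subdiff_closed_graph {N : nat} (f : vec N -> ext) : lsc f -> closed_graph (subdiff f).
Proof.
  intros f_lsc xk uk x u x_conv u_conv u_subdiff.
  assert (f_x_le : forall y fy, f y = Some fy ->
    ele (f x) (Some (fy - inner u (vsub y x)))).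
  { intros y fy f_y.
    apply (lsc_le_lim f xk x (fun k => fy - inner (uk k) (vsub y (xk k)))); [auto..| |].
    - apply CV_minus; [apply Un_cv_const|]. apply inner_cv; [exact u_conv|].
      now apply conv_vsub; [apply conv_const|].
    - intros k. destruct (u_subdiff k) as [fk [-> uk_le]]. specialize (uk_le y).
      rewrite f_y in uk_le. simpl in *. lra. }
  destruct (u_subdiff O) as [f0 [f_x0 _]].
  pose proof (f_x_le _ _ f_x0) as f_x_finite.
  destruct (f x) as [fx|] eqn:f_x; [|contradiction].
  exists fx. split; [exact f_x|]. intros y. destruct (f y) as [fy|] eqn:f_y; [|exact I].
  specialize (f_x_le y fy f_y). simpl in *. lra.
Qed.

Lemma convex_finite {N : nat} (f : vec N -> ext) (x y : vec N) (fx fy t : R) :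
  convex f -> 0 < t < 1 -> f x = Some fx -> f y = Some fy ->
  exists fw, f (vadd (vscal t x) (vscal (1 - t) y)) = Some fw /\
    fw <= t * fx + (1 - t) * fy.
Proof.
  intros f_convex t_range f_x f_y. specialize (f_convex x y fx fy t t_range f_x f_y).
  destruct (f (vadd (vscal t x) (vscal (1 - t) y))) as [fw|]; [now exists fw|contradiction].
Qed.

(* Comparing p with p + t (y - p) and letting t tend to 0 gives the subgradient inequality
   at y. *)
Lemma prox_resolvent {N : nat} (gamma : R) (h : vec N -> ext) (z p : vec N) :
  convex h -> 0 < gamma -> is_prox gamma h z p -> resolvent gamma (subdiff h) z p.
Proof.
  intros h_convex gamma_pos [p_dom p_min].
  destruct (h p) as [hp|] eqn:h_p; [clear p_dom|congruence].
  exists hp. split; [exact h_p|]. intros y. destruct (h y) as [hy|] eqn:h_y; [|exact I].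
  set (a := inner (vsub p z) (vsub y p)). set (b := inner (vsub y p) (vsub y p)).
  assert (ray_min : forall t, 0 < t < 1 -> 0 <= (a + gamma * (hy - hp)) + t * (b / 2)).
  { intros t t_range.
    destruct (convex_finite h y p hy hp t h_convex t_range h_y h_p) as [hw [h_w hw_le]].
    specialize (p_min (vadd (vscal t y) (vscal (1 - t) p))). rewrite h_w in p_min.
    simpl in p_min. rewrite !Rmult_1_r, !norm_sqr in p_min.
    replace (vsub (vadd (vscal t y) (vscal (1 - t) p)) z)
      with (vadd (vsub p z) (vscal t (vsub y p))) in p_min by vec_ring.
    rewrite inner_vadd_l, !inner_vadd_r, !inner_vscal_l, !inner_vscal_r in p_min.
    rewrite (inner_comm (vsub y p) (vsub p z)) in p_min. fold a b in p_min.
    assert (gamma * hw <= gamma * (t * hy + (1 - t) * hp)) by nra.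
    apply (Rmult_le_reg_l t); nra. }
  apply ge0_of_small_perturbations in ray_min. simpl. rewrite inner_vscal_l.
  replace (inner (vsub z p) (vsub y p)) with (- a)
    by (unfold a; autorewrite with inner; ring).
  apply (Rmult_le_reg_l gamma); [exact gamma_pos|].
  replace (gamma * (hp + / gamma * - a)) with (gamma * hp - a) by (field; lra). lra.
Qed.

Lemma resolvent_prox {N : nat} (gamma : R) (h : vec N -> ext) (z p : vec N) :
  0 < gamma -> resolvent gamma (subdiff h) z p -> is_prox gamma h z p.
Proof.
  intros gamma_pos [hp [h_p subgradient_le]]. split; [congruence|].
  intros y. specialize (subgradient_le y). rewrite h_p.
  destruct (h y) as [hy|]; simpl in *; [|exact I]. rewrite !Rmult_1_r, !norm_sqr.
  rewrite inner_vscal_l in subgradient_le.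
  assert (gamma * hp + inner (vsub z p) (vsub y p) <= gamma * hy).
  { apply (Rmult_le_compat_l gamma) in subgradient_le; [|lra].
    replace (gamma * (hp + / gamma * inner (vsub z p) (vsub y p)))
      with (gamma * hp + inner (vsub z p) (vsub y p)) in subgradient_le by (field; lra).
    exact subgradient_le. }
  pose proof (inner_self_ge0 (vsub y p)).
  replace (vsub y z) with (vsub (vsub y p) (vsub z p)) by vec_ring.
  replace (vsub p z) with (vopp (vsub z p)) by vec_ring.
  set (dy := vsub y p) in *. set (dz := vsub z p) in *.
  autorewrite with inner. rewrite (inner_comm dy dz). lra.
Qed.

(** * Separation and the sum rule *)

Definition convex_cone {N : nat} (K : vec N -> R -> Prop) : Prop :=
  (forall w a w' a', K w a -> K w' a' -> K (vadd w w') (a + a')) /\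
  (forall t w a, 0 < t -> K w a -> K (vscal t w) (t * a)).

Definition symmetric_domain {N : nat} (K : vec N -> R -> Prop) : Prop :=
  forall w a, K w a -> exists b, K (vopp w) b.

Lemma exists_separator (L U : R -> Prop) : (exists l, L l) -> (exists u, U u) ->
  (forall l u, L l -> U u -> l <= u) ->
  exists t, (forall l, L l -> l <= t) /\ (forall u, U u -> t <= u).
Proof.
  intros L_inhabited [u0 U_u0] L_le_U.
  destruct (completeness L) as [t [t_ub t_least]]; [|exact L_inhabited|].
  - exists u0. intros l L_l. now apply L_le_U.
  - exists t. split; [exact t_ub|]. intros u U_u. apply t_least. intros l L_l. now apply L_le_U.
Qed.

Section ConeMinorantExtension.

Context {N : nat}.
Variables (K : vec N -> R -> Prop) (phi psi : vec N -> R).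
Hypothesis K_cone : convex_cone K.
Hypothesis phi_lin : linear_form phi.
Hypothesis psi_lin : linear_form psi.
Hypothesis psi_le_on_kernel : forall w a, K w a -> phi w = 0 -> psi w <= a.

(* A positive combination of w and w' lies in the kernel of phi. *)
Lemma cone_slopes_le (w w' : vec N) (a a' : R) :
  K w a -> phi w < 0 -> K w' a' -> 0 < phi w' ->
  (psi w - a) / - phi w <= (a' - psi w') / phi w'.
Proof.
  intros K_w phi_w K_w' phi_w'.
  assert (kernel_le : psi (vadd (vscal (phi w') w) (vscal (- phi w) w'))
                      <= phi w' * a + - phi w * a').
  { destruct K_cone as [K_add K_scal]. apply psi_le_on_kernel.
    - apply K_add; apply K_scal; auto; lra.
    - destruct phi_lin as [phi_add phi_scal]. rewrite phi_add, !phi_scal. ring. }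
  destruct psi_lin as [psi_add psi_scal]. rewrite psi_add, !psi_scal in kernel_le.
  apply (Rmult_le_reg_r (phi w' * - phi w)); [nra|].
  replace ((psi w - a) / - phi w * (phi w' * - phi w))
    with ((psi w - a) * phi w') by (field; lra).
  replace ((a' - psi w') / phi w' * (phi w' * - phi w))
    with ((a' - psi w') * - phi w) by (field; lra).
  lra.
Qed.

(* Each w with phi w < 0 bounds t from below and each w with phi w > 0 bounds it from above. *)
Lemma cone_minorant_extend : symmetric_domain K ->
  exists t, forall w a, K w a -> psi w + t * phi w <= a.
Proof.
  intros K_sym.
  destruct (classic (exists w a, K w a /\ 0 < phi w)) as [[w1 [a1 [K_w1 phi_w1]]]|no_pos].
  - destruct (exists_separator
      (fun r => exists w a, K w a /\ phi w < 0 /\ r = (psi w - a) / - phi w)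
      (fun r => exists w a, K w a /\ 0 < phi w /\ r = (a - psi w) / phi w))
      as [t [lower_le upper_ge]].
    + destruct (K_sym _ _ K_w1) as [b K_opp].
      do 3 eexists. split; [exact K_opp|]. split; [|reflexivity].
      rewrite linear_form_vopp; [lra|exact phi_lin].
    + now exists ((a1 - psi w1) / phi w1), w1, a1.
    + intros l u [w [a [K_w [phi_w ->]]]] [w' [a' [K_w' [phi_w' ->]]]].
      now apply cone_slopes_le.
    + exists t. intros w a K_w. destruct (Rtotal_order (phi w) 0) as [phi_w|[phi_w|phi_w]].
      * assert (slope_le : (psi w - a) / - phi w <= t) by (apply lower_le; eauto).
        apply (Rmult_le_compat_r (- phi w)) in slope_le; [|lra].
        unfold Rdiv in slope_le. rewrite Rmult_assoc, Rinv_l in slope_le; lra.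
      * rewrite phi_w. pose proof (psi_le_on_kernel w a K_w phi_w). lra.
      * assert (slope_ge : t <= (a - psi w) / phi w) by (apply upper_ge; eauto).
        apply (Rmult_le_compat_r (phi w)) in slope_ge; [|lra].
        unfold Rdiv in slope_ge. rewrite Rmult_assoc, Rinv_l in slope_ge; lra.
  - exists 0. intros w a K_w. enough (psi w <= a) by lra.
    apply psi_le_on_kernel; [exact K_w|]. destruct (K_sym _ _ K_w) as [b K_opp].
    apply Rle_antisym; apply Rnot_lt_le; intros phi_w; apply no_pos.
    + eauto.
    + exists (vopp w), b. rewrite linear_form_vopp by exact phi_lin.
      split; [exact K_opp|lra].
Qed.

End ConeMinorantExtension.

Lemma cone_minorant_on_coords {N : nat} (coords : list (Fin.t N)) (K : vec N -> R -> Prop) :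
  convex_cone K -> symmetric_domain K ->
  (forall w a, K w a -> (forall i, In i coords -> w i = 0) -> 0 <= a) ->
  exists psi, linear_form psi /\ forall w a, K w a -> psi w <= a.
Proof.
  revert K. induction coords as [|i coords IH]; intros K K_cone K_sym K_ge0.
  - exists (fun _ => 0). split; [split; intros; ring|].
    intros w a K_w. apply (K_ge0 w a K_w). intros i [].
  - destruct (IH (fun w a => K w a /\ w i = 0)) as [psi [psi_lin psi_le]].
    + destruct K_cone as [K_add K_scal]. split.
      * intros w a w' a' [K_w w_i] [K_w' w'_i]. split; [now apply K_add|].
        unfold vadd. lra.
      * intros t w a t_pos [K_w w_i]. split; [now apply K_scal|].
        unfold vscal. rewrite w_i. ring.
    + intros w a [K_w w_i]. destruct (K_sym w a K_w) as [b K_opp]. exists b.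
      split; [exact K_opp|]. unfold vopp. lra.
    + intros w a [K_w w_i] w_coords. apply (K_ge0 w a K_w).
      intros j [<-|j_in]; [exact w_i|now apply w_coords].
    + destruct (cone_minorant_extend K (fun w => w i) psi) as [t ext_le]; auto.
      { apply linear_form_coord. }
      exists (fun w => psi w + t * w i). split; [|exact ext_le].
      apply linear_form_add_mul; [exact psi_lin|apply linear_form_coord].
Qed.

Lemma cone_minorant {N : nat} (K : vec N -> R -> Prop) :
  convex_cone K -> symmetric_domain K -> (forall a, K vzero a -> 0 <= a) ->
  exists u, forall w a, K w a -> inner u w <= a.
Proof.
  intros K_cone K_sym K_ge0. destruct (Fin_Finite N) as [coords coords_full].
  destruct (cone_minorant_on_coords coords K K_cone K_sym) as [psi [psi_lin psi_le]].
  - intros w a K_w w_null. apply K_ge0. replace vzero with w; [exact K_w|].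
    extensionality i. apply w_null, coords_full.
  - destruct (linear_form_inner psi psi_lin) as [u psi_eq]. exists u.
    intros w a K_w. rewrite <- psi_eq. now apply psi_le.
Qed.

Definition cone_hull {N : nat} (E : vec N -> R -> Prop) (w : vec N) (a : R) : Prop :=
  exists t w0 a0, 0 < t /\ E w0 a0 /\ w = vscal t w0 /\ a = t * a0.

Definition jointly_convex {N : nat} (E : vec N -> R -> Prop) : Prop :=
  forall w a w' a' t, 0 < t < 1 -> E w a -> E w' a' ->
    E (vadd (vscal t w) (vscal (1 - t) w')) (t * a + (1 - t) * a').

Lemma cone_hull_convex_cone {N : nat} (E : vec N -> R -> Prop) :
  jointly_convex E -> convex_cone (cone_hull E).
Proof.
  intros E_convex. split.
  - intros w a w' a' [t [w0 [a0 [t_pos [E_w0 [-> ->]]]]]]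
      [t' [w0' [a0' [t'_pos [E_w0' [-> ->]]]]]].
    assert (q_range : 0 < t / (t + t') < 1).
    { split; [apply Rdiv_lt_0_compat; lra|]. apply (Rmult_lt_reg_r (t + t')); [lra|].
      replace (t / (t + t') * (t + t')) with t by (field; lra). lra. }
    exists (t + t'), (vadd (vscal (t / (t + t')) w0) (vscal (1 - t / (t + t')) w0')),
      (t / (t + t') * a0 + (1 - t / (t + t')) * a0').
    split; [lra|]. split; [now apply E_convex|].
    split; [vec_ext|]; field; lra.
  - intros s w a s_pos [t [w0 [a0 [t_pos [E_w0 [-> ->]]]]]].
    exists (s * t), w0, a0. split; [now apply Rmult_lt_0_compat|].
    split; [exact E_w0|]. split; [vec_ring|ring].
Qed.

Lemma jointly_convex_minorant {N : nat} (E : vec N -> R -> Prop) : jointly_convex E ->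
  (forall w a, E w a -> exists s b, 0 < s /\ E (vscal (- s) w) b) ->
  (forall a, E vzero a -> 0 <= a) -> exists u, forall w a, E w a -> inner u w <= a.
Proof.
  intros E_convex E_core E_ge0.
  destruct (cone_minorant (cone_hull E)) as [u u_le].
  - now apply cone_hull_convex_cone.
  - intros w a [t [w0 [a0 [t_pos [E_w0 [-> ->]]]]]].
    destruct (E_core w0 a0 E_w0) as [s [b [s_pos E_opp]]].
    exists (t / s * b), (t / s), (vscal (- s) w0), b.
    split; [now apply Rdiv_lt_0_compat|]. split; [exact E_opp|].
    split; [vec_ext; field; lra|reflexivity].
  - intros a [t [w0 [a0 [t_pos [E_w0 [w0_eq ->]]]]]]. apply Rmult_le_pos; [lra|].
    apply E_ge0. replace vzero with w0; [exact E_w0|]. extensionality i.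
    apply (f_equal (fun w => w i)) in w0_eq. unfold vscal, vzero in *. nra.
  - exists u. intros w a E_w. apply u_le. exists 1, w, a.
    split; [lra|]. split; [exact E_w|]. split; [vec_ring|ring].
Qed.

Lemma ri_prolong {N : nat} (A : set N) (y x : vec N) : ri A y -> A x ->
  exists t, 0 < t /\ forall s, 0 < s <= t -> A (vsub y (vscal s (vsub x y))).
Proof.
  intros [A_y [e [e_pos near_A]]] A_x. pose proof (norm_ge0 (vsub x y)).
  destruct (exists_pos_mul_lt (norm (vsub x y)) e) as [t [t_pos t_small]]; [auto..|].
  exists t. split; [exact t_pos|]. intros s s_range. apply near_A.
  - exists ((1 + s, y) :: (- s, x) :: nil). split; [now repeat constructor|].
    split; simpl; [ring|vec_ring].
  - replace (vsub (vsub y (vscal s (vsub x y))) y) with (vscal (- s) (vsub x y)) by vec_ring.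
    rewrite norm_vscal, Rabs_Ropp, Rabs_right by lra. nra.
Qed.

(* The set E below is, up to its boundary, the epigraph of the perturbation function
   w |-> inf_x f(x) + g(x + w) - m; the qualification condition puts 0 in the relative
   interior of its domain. *)
Lemma convex_sandwich {N : nat} (f g : vec N -> ext) (m : R) :
  convex f -> convex g -> (exists y, ri (dom f) y /\ ri (dom g) y) ->
  (forall x, ele (Some m) (eadd (f x) (g x))) ->
  exists u, forall x y fx gy, f x = Some fx -> g y = Some gy ->
    m + inner u (vsub y x) <= fx + gy.
Proof.
  intros f_convex g_convex [y0 [y0_ri_f y0_ri_g]] m_le.
  set (E := fun w a => exists x y fx gy,
    f x = Some fx /\ g y = Some gy /\ w = vsub y x /\ fx + gy - m <= a).
  destruct (jointly_convex_minorant E) as [u u_le].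
  - intros w a w' a' t t_range [x [y [fx [gy [f_x [g_y [-> a_ge]]]]]]]
      [x' [y' [fx' [gy' [f_x' [g_y' [-> a'_ge]]]]]]].
    destruct (convex_finite f x x' fx fx' t f_convex t_range f_x f_x') as [fw [f_w fw_le]].
    destruct (convex_finite g y y' gy gy' t g_convex t_range g_y g_y') as [gw [g_w gw_le]].
    do 4 eexists. split; [exact f_w|]. split; [exact g_w|]. split; [vec_ring|nra].
  - intros w a [x [y [fx [gy [f_x [g_y [-> _]]]]]]].
    destruct (ri_prolong _ y0 x y0_ri_f) as [s1 [s1_pos dom_f]]; [unfold dom; congruence|].
    destruct (ri_prolong _ y0 y y0_ri_g) as [s2 [s2_pos dom_g]]; [unfold dom; congruence|].
    set (s := Rmin s1 s2). assert (s_pos : 0 < s) by now apply Rmin_glb_lt.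
    specialize (dom_f s (conj s_pos (Rmin_l _ _))).
    specialize (dom_g s (conj s_pos (Rmin_r _ _))). unfold dom in *.
    destruct (f (vsub y0 (vscal s (vsub x y0)))) as [fs|] eqn:f_s; [|congruence].
    destruct (g (vsub y0 (vscal s (vsub y y0)))) as [gs|] eqn:g_s; [|congruence].
    exists s, (fs + gs - m). split; [exact s_pos|].
    do 4 eexists. split; [exact f_s|]. split; [exact g_s|]. split; [vec_ring|lra].
  - intros a [x [y [fx [gy [f_x [g_y [w_eq a_ge]]]]]]].
    assert (y = x) as ->.
    { extensionality i. apply (f_equal (fun w => w i)) in w_eq. unfold vsub, vzero in w_eq.
      lra. }
    specialize (m_le x). rewrite f_x, g_y in m_le. simpl in m_le. lra.
  - exists u. intros x y fx gy f_x g_y. enough (inner u (vsub y x) <= fx + gy - m) by lra.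
    apply u_le. exists x, y, fx, gy. repeat split; auto. lra.
Qed.

Lemma argmin_sum_subdiff {N : nat} (f g : vec N -> ext) (x : vec N) :
  convex f -> convex g -> (exists y, ri (dom f) y /\ ri (dom g) y) ->
  argmin_sum f g x -> exists u, subdiff g x u /\ subdiff f x (vopp u).
Proof.
  intros f_convex g_convex qualification [m [m_eq m_le]].
  destruct (convex_sandwich f g m f_convex g_convex qualification m_le) as [u u_le]. exists u.
  destruct (f x) as [fx|] eqn:f_x; [|discriminate].
  destruct (g x) as [gx|] eqn:g_x; [|discriminate]. injection m_eq as <-. split.
  - exists gx. split; [exact g_x|]. intros y. destruct (g y) as [gy|] eqn:g_y; [|exact I].
    specialize (u_le x y fx gy f_x g_y). simpl. lra.
  - exists fx. split; [exact f_x|]. intros y. destruct (f y) as [fy|] eqn:f_y; [|exact I].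
    specialize (u_le y x fy gx f_y g_x). simpl. autorewrite with inner in *. lra.
Qed.

Lemma subdiff_argmin_sum {N : nat} (f g : vec N -> ext) (x u : vec N) :
  subdiff g x u -> subdiff f x (vopp u) -> argmin_sum f g x.
Proof.
  intros [gx [g_x u_le]] [fx [f_x opp_u_le]]. exists (fx + gx).
  rewrite f_x, g_x. split; [reflexivity|].
  intros y. specialize (u_le y). specialize (opp_u_le y).
  destruct (f y) as [fy|]; simpl in *; [|exact I].
  destruct (g y) as [gy|]; simpl in *; [|exact I].
  rewrite inner_vopp_l in opp_u_le. lra.
Qed.

(** * Relative interiors of convex sets *)

Definition lincomb {N : nat} (l : list (R * vec N)) : vec N :=
  fold_right (fun p acc => vadd (vscal (fst p) (snd p)) acc) vzero l.

Definition weight {N : nat} (l : list (R * vec N)) : R :=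
  fold_right (fun p s => fst p + s) 0 l.

Lemma weight_le {N : nat} (l : list (R * vec N)) (c : R) :
  Forall (fun p => fst p <= c) l -> weight l <= c * INR (length l).
Proof.
  intros l_le. unfold weight.
  induction l_le as [|p l p_le _ IH]; simpl length; [simpl; lra|]. rewrite S_INR. simpl. lra.
Qed.

(* For l = [(phi_1, d_1); ...; (phi_m, d_m)] this is the sum of the phi_j(w) d_j. *)
Definition expand {N : nat} (l : list ((vec N -> R) * vec N)) (w : vec N) : vec N :=
  lincomb (map (fun q => (fst q w, snd q)) l).

Lemma expand_cons {N : nat} (q : (vec N -> R) * vec N) l (w : vec N) :
  expand (q :: l) w = vadd (vscal (fst q w) (snd q)) (expand l w).
Proof. reflexivity. Qed.

Lemma linear_form_expand {N : nat} (l : list ((vec N -> R) * vec N)) (i : Fin.t N) :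
  Forall (fun q => linear_form (fst q)) l -> linear_form (fun w => expand l w i).
Proof.
  intros l_lin. induction l_lin as [|q l q_lin _ IH].
  - unfold expand. simpl. unfold vzero. split; intros; ring.
  - replace (fun w => expand (q :: l) w i)
      with (fun w => expand l w i + snd q i * fst q w); [now apply linear_form_add_mul|].
    extensionality w. rewrite expand_cons. unfold vadd, vscal. ring.
Qed.

Lemma expand_vadd_vscal {N : nat} (l : list ((vec N -> R) * vec N)) (s : R) (a b : vec N) :
  Forall (fun q => linear_form (fst q)) l ->
  expand l (vadd (vscal s a) b) = vadd (vscal s (expand l a)) (expand l b).
Proof.
  intros l_lin. extensionality i.
  destruct (linear_form_expand l i l_lin) as [expand_add expand_scal].
  rewrite expand_add, expand_scal. reflexivity.
Qed.

Lemma expand_lincomb {N : nat} (l : list ((vec N -> R) * vec N)) (c : list (R * vec N)) :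
  Forall (fun q => linear_form (fst q)) l -> Forall (fun p => expand l (snd p) = snd p) c ->
  expand l (lincomb c) = lincomb c.
Proof.
  intros l_lin c_fixed. induction c_fixed as [|p c p_fixed _ IH]; simpl.
  - extensionality i. now apply (linear_form_vzero (fun w => expand l w i)), linear_form_expand.
  - now rewrite expand_vadd_vscal, IH, p_fixed.
Qed.

(* One step of Gaussian elimination: d is added to the list with a coefficient that corrects
   coordinate i of the residual w - expand l w. *)
Lemma expand_pivot {N : nat} (l : list ((vec N -> R) * vec N)) (c : vec N -> R)
  (d w : vec N) :
  expand ((c, d) :: map (fun q => (fun w => fst q w - c w * fst q d, snd q)) l) w
  = vadd (expand l w) (vscal (c w) (vsub d (expand l d))).
Proof.
  rewrite expand_cons. simpl.
  enough (pivot_eq : expand (map (fun q => (fun w => fst q w - c w * fst q d, snd q)) l) w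
            = vsub (expand l w) (vscal (c w) (expand l d)))
    by (rewrite pivot_eq; vec_ring).
  induction l as [|q l IH].
  - unfold expand. simpl. vec_ring.
  - simpl map. rewrite !expand_cons, IH. simpl. vec_ring.
Qed.

Definition frame_on {N : nat} (coords : list (Fin.t N)) (A : set N)
  (l : list ((vec N -> R) * vec N)) : Prop :=
  Forall (fun q => linear_form (fst q)) l /\ Forall (fun q => A (snd q)) l /\
  forall w i, A w -> In i coords -> expand l w i = w i.

Lemma exists_frame_on {N : nat} (coords : list (Fin.t N)) (A : set N) :
  exists l, frame_on coords A l.
Proof.
  induction coords as [|i coords [l [l_lin [l_in l_frame]]]].
  - exists nil. repeat split; [constructor..|]. intros w i _ [].
  - destruct (classic (exists d, A d /\ d i - expand l d i <> 0))
      as [[d [A_d pivot_ne0]]|no_pivot].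
    + set (rho := d i - expand l d i) in *.
      set (c := fun w : vec N => / rho * (w i + -1 * expand l w i)).
      assert (c_lin : linear_form c).
      { assert (res_lin : linear_form (fun w => w i + -1 * expand l w i))
          by (apply linear_form_add_mul;
              [apply linear_form_coord|now apply linear_form_expand]).
        destruct res_lin as [res_add res_scal].
        split; intros; unfold c; [rewrite res_add|rewrite res_scal]; ring. }
      exists ((c, d) :: map (fun q => (fun w => fst q w - c w * fst q d, snd q)) l).
      repeat split.
      * constructor; [exact c_lin|]. apply Forall_map.
        eapply Forall_impl; [|exact l_lin]. intros q q_lin. simpl.
        replace (fun w => fst q w - c w * fst q d)
          with (fun w => fst q w + - fst q d * c w) by (extensionality w; ring).
        now apply linear_form_add_mul.
      * constructor; [exact A_d|]. now apply Forall_map.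
      * intros w j A_w [<-|j_in]; rewrite expand_pivot; unfold vadd, vscal, vsub.
        -- fold rho. unfold c. field. exact pivot_ne0.
        -- rewrite !l_frame by assumption. ring.
    + exists l. repeat split; [exact l_lin|exact l_in|].
      intros w j A_w [<-|j_in]; [|now apply l_frame].
      apply NNPP. intros ne. apply no_pivot. exists w. split; [exact A_w|lra].
Qed.

Definition frame {N : nat} (A : set N) (l : list ((vec N -> R) * vec N)) : Prop :=
  Forall (fun q => linear_form (fst q)) l /\ Forall (fun q => A (snd q)) l /\
  forall w, A w -> expand l w = w.

Lemma exists_frame {N : nat} (A : set N) : exists l, frame A l.
Proof.
  destruct (Fin_Finite N) as [coords coords_full].
  destruct (exists_frame_on coords A) as [l [l_lin [l_in l_frame]]].
  exists l. repeat split; [exact l_lin|exact l_in|].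
  intros w A_w. extensionality i. now apply l_frame.
Qed.

Lemma frame_expand_aff {N : nat} (A : set N) (l : list ((vec N -> R) * vec N)) (y : vec N) :
  frame A l -> aff A y -> expand l y = y.
Proof.
  intros [l_lin [_ l_frame]] [c [c_in [_ ->]]]. apply expand_lincomb; [exact l_lin|].
  eapply Forall_impl; [|exact c_in]. intros p A_p. now apply l_frame.
Qed.

Lemma convex_set_lincomb_scaled {N : nat} (A : set N) (l : list (R * vec N)) :
  convex_set A -> A vzero -> Forall (fun p => 0 <= fst p /\ A (snd p)) l ->
  0 <= weight l /\ exists a, A a /\ lincomb l = vscal (weight l) a.
Proof.
  intros A_convex A_0 l_in.
  induction l_in as [|[t w] l [t_ge0 A_w] _ [s_ge0 [a [A_a l_eq]]]]; simpl in *.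
  - split; [lra|]. exists vzero. split; [exact A_0|vec_ring].
  - split; [lra|]. rewrite l_eq. set (s := weight l) in *.
    destruct (Req_dec (t + s) 0) as [sum_null|sum_ne0].
    + exists vzero. split; [exact A_0|]. replace t with 0 by lra. replace s with 0 by lra.
      vec_ring.
    + exists (vadd (vscal (t / (t + s)) w) (vscal (1 - t / (t + s)) a)). split.
      * apply A_convex; auto. split; [apply Rle_mult_inv_pos; lra|].
        apply (Rmult_le_reg_r (t + s)); [lra|].
        replace (t / (t + s) * (t + s)) with t by (field; lra). lra.
      * vec_ext. field. exact sum_ne0.
Qed.

Lemma convex_set_lincomb {N : nat} (A : set N) (l : list (R * vec N)) :
  convex_set A -> A vzero -> Forall (fun p => 0 <= fst p /\ A (snd p)) l ->
  weight l <= 1 -> A (lincomb l).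
Proof.
  intros A_convex A_0 l_in weight_le.
  destruct (convex_set_lincomb_scaled A l A_convex A_0 l_in) as [weight_ge0 [a [A_a ->]]].
  replace (vscal (weight l) a)
    with (vadd (vscal (weight l) a) (vscal (1 - weight l) vzero)) by vec_ring.
  now apply A_convex.
Qed.

Definition frame_sum {N : nat} (l : list ((vec N -> R) * vec N)) : vec N :=
  lincomb (map (fun q => (1, snd q)) l).

Lemma frame_sum_near {N : nat} (A : set N) (l : list ((vec N -> R) * vec N)) (s : R)
  (h : vec N) : convex_set A -> A vzero -> Forall (fun q => A (snd q)) l ->
  Forall (fun q => Rabs (fst q h) <= s) l -> 2 * s * INR (length l) <= 1 ->
  A (vadd (vscal s (frame_sum l)) (expand l h)).
Proof.
  intros A_convex A_0 l_in coef_le length_le.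
  assert (coef_range : Forall (fun q => 0 <= s + fst q h <= 2 * s) l).
  { eapply Forall_impl; [|exact coef_le]. simpl. intros q q_le.
    pose proof (Rle_abs (fst q h)). pose proof (Rle_abs (- fst q h)) as opp_le.
    rewrite Rabs_Ropp in opp_le. lra. }
  set (c := map (fun q => (s + fst q h, snd q)) l).
  replace (vadd (vscal s (frame_sum l)) (expand l h)) with (lincomb c).
  - apply (convex_set_lincomb A); [exact A_convex|exact A_0| |].
    + apply Forall_map, Forall_forall. rewrite Forall_forall in coef_range, l_in.
      intros q q_in. split; [apply (coef_range q q_in)|now apply l_in].
    + rewrite <- (length_map (fun q => (s + fst q h, snd q)) l) in length_le.
      eapply Rle_trans; [|exact length_le]. apply weight_le, Forall_map.
      eapply Forall_impl; [|exact coef_range]. intros q q_range. apply q_range.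
  - unfold c, frame_sum. clear. induction l as [|q l IH].
    + unfold expand. simpl. vec_ring.
    + rewrite expand_cons. simpl. rewrite IH. vec_ring.
Qed.

(* For a frame d_1, ..., d_m of A and small s > 0, the point s (d_1 + ... + d_m) lies in the
   relative interior of A. *)
Lemma convex_zero_cl_ri {N : nat} (A : set N) :
  convex_set A -> A vzero -> cl (ri A) vzero.
Proof.
  intros A_convex A_0 e e_pos.
  destruct (exists_frame A) as [l l_frame]. pose proof l_frame as [l_lin [l_in l_expand]].
  destruct (linear_forms_bounded (map fst l)) as [L [L_pos forms_le]];
    [now apply Forall_map|]. apply -> Forall_map in forms_le.
  destruct (exists_pos_mul_lt_both (norm (frame_sum l)) (2 * INR (length l)) e 1)
    as [s [s_pos [s_norm s_length]]];
    [apply norm_ge0|pose proof (pos_INR (length l)); lra|exact e_pos|lra|].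
  assert (near : forall h, expand l h = h -> norm h < s / L ->
    A (vadd (vscal s (frame_sum l)) h)).
  { intros h h_fixed h_small. rewrite <- h_fixed.
    apply frame_sum_near; [exact A_convex|exact A_0|exact l_in| |lra].
    eapply Forall_impl; [|exact forms_le]. simpl. intros q q_le. specialize (q_le h).
    apply (Rmult_lt_compat_l L) in h_small; [|exact L_pos].
    replace (L * (s / L)) with s in h_small by (field; lra). lra. }
  assert (sum_fixed : expand l (frame_sum l) = frame_sum l).
  { apply expand_lincomb; [exact l_lin|]. apply Forall_map.
    eapply Forall_impl; [|exact l_in]. intros q. apply l_expand. }
  assert (sL_pos : 0 < s / L) by now apply Rdiv_lt_0_compat.
  exists (vscal s (frame_sum l)). split; [split|].
  - replace (vscal s (frame_sum l)) with (vadd (vscal s (frame_sum l)) vzero) by vec_ring.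
    apply near; [now apply l_expand|]. now rewrite norm_vzero.
  - exists (s / L). split; [exact sL_pos|]. intros y y_aff y_close.
    set (h := vsub y (vscal s (frame_sum l))) in *.
    replace y with (vadd (vscal s (frame_sum l)) h) by (unfold h; vec_ring).
    apply near; [|exact y_close].
    replace h with (vadd (vscal (- s) (frame_sum l)) y) by (unfold h; vec_ring).
    now rewrite expand_vadd_vscal, sum_fixed, (frame_expand_aff A l y).
  - replace (vsub (vscal s (frame_sum l)) vzero) with (vscal s (frame_sum l)) by vec_ring.
    rewrite norm_vscal, Rabs_right by lra. exact s_norm.
Qed.

Lemma aff_translate {N : nat} (A : set N) (u y : vec N) :
  aff A y -> aff (fun w => A (vadd u w)) (vsub y u).
Proof.
  intros [c [c_in [weight_eq ->]]].
  exists (map (fun p => (fst p, vsub (snd p) u)) c). split; [|split].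
  - apply Forall_map. eapply Forall_impl; [|exact c_in]. intros p A_p. simpl.
    now replace (vadd u (vsub (snd p) u)) with (snd p) by vec_ring.
  - rewrite <- weight_eq. clear. induction c as [|p c IH]; [reflexivity|].
    simpl. now rewrite IH.
  - replace (vsub (fold_right _ _ c) u) with (vsub (lincomb c) (vscal (weight c) u))
      by (unfold weight; rewrite weight_eq; unfold lincomb; vec_ring).
    clear. induction c as [|p c IH]; simpl; [vec_ring|]. rewrite <- IH. vec_ring.
Qed.

Lemma ri_translate {N : nat} (A : set N) (u w : vec N) :
  ri (fun w => A (vadd u w)) w -> ri A (vadd u w).
Proof.
  intros [A_w [e [e_pos near_A]]]. split; [exact A_w|]. exists e. split; [exact e_pos|].
  intros y y_aff y_close. replace y with (vadd u (vsub y u)) by vec_ring.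
  apply near_A; [now apply aff_translate|].
  now replace (vsub (vsub y u) w) with (vsub y (vadd u w)) by vec_ring.
Qed.

Lemma convex_subset_cl_ri {N : nat} (C : set N) : convex_set C -> subset C (cl (ri C)).
Proof.
  intros C_convex u C_u e e_pos.
  destruct (convex_zero_cl_ri (fun w => C (vadd u w))) with (e := e)
    as [w [w_ri w_close]]; [| |exact e_pos|].
  - intros a b t t_range C_a C_b.
    replace (vadd u (vadd (vscal t a) (vscal (1 - t) b)))
      with (vadd (vscal t (vadd u a)) (vscal (1 - t) (vadd u b))) by vec_ring.
    now apply C_convex.
  - now replace (vadd u vzero) with u by vec_ring.
  - exists (vadd u w). split; [now apply ri_translate|].
    now replace (vsub (vadd u w) u) with (vsub w vzero) by vec_ring.
Qed.

(** * Identification of strata *)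

Lemma cl_subset {N : nat} (A B : set N) : subset A B -> subset (cl A) (cl B).
Proof.
  intros A_sub_B x x_cl e e_pos. destruct (x_cl e e_pos) as [y [A_y y_close]].
  exists y. auto.
Qed.

Lemma subset_cl {N : nat} (A : set N) : subset A (cl A).
Proof.
  intros x A_x e e_pos. exists x. split; [exact A_x|].
  replace (vsub x x) with (@vzero N) by vec_ring. now rewrite norm_vzero.
Qed.

Lemma cl_eventually {N : nat} (A : set N) (s : nat -> vec N) (l : vec N) : conv s l ->
  exists K, forall k, (K <= k)%nat -> cl A (s k) -> cl A l.
Proof.
  intros s_conv. destruct (classic (cl A l)) as [l_cl|l_notcl]; [now exists O|].
  apply not_all_ex_not in l_notcl. destruct l_notcl as [e l_far].
  apply imply_to_and in l_far. destruct l_far as [e_pos l_far].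
  destruct (s_conv (e / 2)) as [K s_close]; [lra|]. exists K. intros k k_ge sk_cl.
  exfalso. apply l_far. destruct (sk_cl (e / 2)) as [y [A_y y_close]]; [lra|].
  exists y. split; [exact A_y|]. specialize (s_close k k_ge).
  pose proof (norm_vsub_triangle y (s k) l). lra.
Qed.

Lemma cl_list_eventually {N : nat} (S : list (set N)) (s : nat -> vec N) (l : vec N) :
  conv s l ->
  exists K, forall k, (K <= k)%nat -> forall M, In M S -> cl M (s k) -> cl M l.
Proof.
  intros s_conv. induction S as [|M S [K1 S_cl]].
  - exists O. intros k _ M [].
  - destruct (cl_eventually M s l s_conv) as [K2 M_cl]. exists (max K1 K2).
    intros k k_ge M' [<-|M'_in]; [apply M_cl; lia|apply S_cl; [lia|exact M'_in]].
Qed.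

Lemma strat_le_eventually {N : nat} (D : set N) (S : list (set N)) (s : nat -> vec N)
  (l : vec N) : stratification D S -> conv s l ->
  exists K, forall k, (K <= k)%nat -> forall M M',
    stratum S l M -> In M' S -> cl M' (s k) -> strat_le M M'.
Proof.
  intros [_ [_ [_ frontier]]] s_conv.
  destruct (cl_list_eventually S s l s_conv) as [K l_cl].
  exists K. intros k k_ge M M' [M_in M_l] M'_in sk_cl.
  apply frontier; [exact M_in|exact M'_in|]. exists l. split; [exact M_l|].
  now apply (l_cl k).
Qed.

Lemma subdiff_cl_J {N : nat} (h : vec N -> ext) (M : set N) (x u : vec N) :
  M x -> subdiff h x u -> cl (J h M) u.
Proof.
  intros M_x u_subdiff. apply (cl_subset (ri (subdiff h x))).
  - intros w w_ri. now exists x.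
  - apply convex_subset_cl_ri; [apply subdiff_convex_set|exact u_subdiff].
Qed.

Lemma strat_le_subset {N : nat} (A A' B B' : set N) :
  subset A' A -> subset B B' -> strat_le A B -> strat_le A' B'.
Proof. intros A'_sub B_sub A_le_B x A'_x. apply (cl_subset B B' B_sub). auto. Qed.

Lemma mirror_strat_le_J_conjf {N : nat} (h : vec N -> ext) (S Ss : list (set N))
  (M Ms : set N) : mirror_strat h S Ss -> In M S -> In Ms Ss ->
  strat_le Ms (J h M) -> strat_le M (J (conjf h) Ms).
Proof.
  intros [_ [_ [_ [J_conjf [inverse order_reversing]]]]] M_in Ms_in Ms_le.
  destruct (J_conjf Ms Ms_in) as [M' [M'_in M'_eq]].
  assert (Ms_eq : set_eq Ms (J h M'))
    by (apply inverse; [assumption..|]; intros x; symmetry; apply M'_eq).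
  apply (strat_le_subset M M M' (J (conjf h) Ms)); [now intros x|intros x; apply M'_eq|].
  apply order_reversing; [exact M_in|exact M'_in|].
  apply (strat_le_subset Ms (J h M') (J h M) (J h M)); [intros x; apply Ms_eq|now intros x|].
  exact Ms_le.
Qed.

Lemma mirror_strat_identification {N : nat} (h : vec N -> ext) (S Ss : list (set N))
  (xk uk : nat -> vec N) (x u : vec N) :
  mirror_strat h S Ss -> conv xk x -> conv uk u -> (forall k, subdiff h (xk k) (uk k)) ->
  exists K, forall k, (K <= k)%nat -> forall M1 M2 M3,
    stratum S x M1 -> stratum S (xk k) M2 -> stratum Ss u M3 ->
    strat_le M1 M2 /\ strat_le M2 (J (conjf h) M3).
Proof.
  intros h_mirror x_conv u_conv u_subdiff.
  pose proof h_mirror as [S_strat [Ss_strat [J_in _]]].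
  destruct (strat_le_eventually _ S xk x S_strat x_conv) as [K1 primal_le].
  destruct (strat_le_eventually _ Ss uk u Ss_strat u_conv) as [K2 dual_le].
  exists (max K1 K2). intros k k_ge M1 M2 M3 x_M1 [M2_in M2_xk] u_M3. split.
  - apply (primal_le k); [lia|exact x_M1|exact M2_in|]. now apply subset_cl.
  - apply (mirror_strat_le_J_conjf h S Ss); [exact h_mirror|exact M2_in|apply u_M3|].
    destruct (J_in M2 M2_in) as [Ms2 [Ms2_in Ms2_eq]].
    apply (strat_le_subset M3 M3 Ms2 (J h M2)); [now intros w|intros w; apply Ms2_eq|].
    apply (dual_le k); [lia|exact u_M3|exact Ms2_in|].
    apply (cl_subset (J h M2)); [intros w; apply Ms2_eq|].
    now apply (subdiff_cl_J h M2 (xk k)).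
Qed.

Lemma mirror_strat_resolvent_identification {N : nat} (gamma : R) (h : vec N -> ext)
  (S Ss : list (set N)) (zk pk : nat -> vec N) (z p : vec N) :
  mirror_strat h S Ss -> conv zk z -> conv pk p ->
  (forall k, resolvent gamma (subdiff h) (zk k) (pk k)) ->
  exists K, forall k, (K <= k)%nat -> forall M1 M2 M3,
    stratum S p M1 -> stratum S (pk k) M2 -> stratum Ss (vscal (/ gamma) (vsub z p)) M3 ->
    strat_le M1 M2 /\ strat_le M2 (J (conjf h) M3).
Proof.
  intros h_mirror z_conv p_conv p_res.
  apply (mirror_strat_identification h S Ss pk
    (fun k => vscal (/ gamma) (vsub (zk k) (pk k)))); auto.
  now apply conv_vscal, conv_vsub.
Qed.

(** * Firmly nonexpansive operators and the Krasnoselskii-Mann iteration *)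

Definition firmly_nonexpansive {N : nat} (T : vec N -> vec N -> Prop) : Prop :=
  forall z p z' p', T z p -> T z' p' ->
    inner (vsub p p') (vsub p p') <= inner (vsub z z') (vsub p p').

Lemma firmly_nonexpansive_norm_le {N : nat} (T : vec N -> vec N -> Prop)
  (z p z' p' : vec N) : firmly_nonexpansive T -> T z p -> T z' p' ->
  norm (vsub p p') <= norm (vsub z z').
Proof.
  intros T_firm T_z T_z'. specialize (T_firm z p z' p' T_z T_z').
  rewrite <- norm_sqr in T_firm. pose proof (inner_le_norm (vsub z z') (vsub p p')).
  pose proof (norm_ge0 (vsub p p')). pose proof (norm_ge0 (vsub z z')). nra.
Qed.

Lemma firmly_nonexpansive_conv {N : nat} (T : vec N -> vec N -> Prop)
  (zk pk : nat -> vec N) (z : vec N) : firmly_nonexpansive T -> closed_graph T ->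
  conv zk z -> (forall k, T (zk k) (pk k)) -> exists p, T z p /\ conv pk p.
Proof.
  intros T_firm T_closed z_conv T_zk.
  destruct (conv_bounded (fun k => vsub (zk k) (zk O)) (vsub z (zk O))) as [B z_le].
  { apply conv_vsub; [exact z_conv|apply conv_const]. }
  destruct (bounded_conv_reindexing pk (B + norm (pk O))) as [p [phi [phi_ge p_conv]]].
  { intros k. eapply Rle_trans; [apply (norm_le_vsub _ (pk O))|]. apply Rplus_le_compat_r.
    eapply Rle_trans; [|apply (z_le k)].
    apply (firmly_nonexpansive_norm_le T); auto. }
  assert (T_z : T z p).
  { apply (T_closed (fun n => zk (phi n)) (fun n => pk (phi n)));
      [now apply conv_reindexing|exact p_conv|auto]. }
  exists p. split; [exact T_z|]. intros e e_pos. destruct (z_conv e e_pos) as [K z_close].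
  exists K. intros k k_ge. eapply Rle_lt_trans; [|apply (z_close k k_ge)].
  now apply (firmly_nonexpansive_norm_le T).
Qed.

Lemma resolvent_firmly_nonexpansive {N : nat} (gamma : R) (A : vec N -> vec N -> Prop) :
  0 < gamma -> monotone A -> firmly_nonexpansive (resolvent gamma A).
Proof.
  intros gamma_pos A_mono z p z' p' p_res p'_res.
  pose proof (A_mono _ _ _ _ p_res p'_res) as mono.
  replace (vsub (vscal (/ gamma) (vsub z p)) (vscal (/ gamma) (vsub z' p')))
    with (vscal (/ gamma) (vsub (vsub z z') (vsub p p'))) in mono by vec_ring.
  rewrite inner_vscal_l, inner_vsub_l in mono. apply Rinv_0_lt_compat in gamma_pos.
  enough (0 <= inner (vsub z z') (vsub p p') - inner (vsub p p') (vsub p p')) by lra.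
  apply (Rmult_le_reg_l (/ gamma)); lra.
Qed.

Lemma resolvent_closed_graph {N : nat} (gamma : R) (A : vec N -> vec N -> Prop) :
  closed_graph A -> closed_graph (resolvent gamma A).
Proof.
  intros A_closed zk pk z p z_conv p_conv p_res.
  apply (A_closed pk (fun k => vscal (/ gamma) (vsub (zk k) (pk k)))); [exact p_conv| |auto].
  now apply conv_vscal, conv_vsub.
Qed.

Lemma fejer_cluster_conv {N : nat} (z : nat -> vec N) (l : vec N) (phi : nat -> nat) :
  (forall k, norm (vsub (z (S k)) l) <= norm (vsub (z k) l)) ->
  conv (fun n => z (phi n)) l -> conv z l.
Proof.
  intros z_fejer cluster e e_pos. destruct (cluster e e_pos) as [n z_close].
  exists (phi n). intros k k_ge. eapply Rle_lt_trans; [|apply (z_close n (le_n n))].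
  apply (decreasing_prop (fun k => norm (vsub (z k) l))); [exact z_fejer|exact k_ge].
Qed.

Lemma weighted_decrease_cv_0 (w q d : nat -> R) : (forall k, 0 <= w k) ->
  cv_infty (fun n => sum_f_R0 w n) -> (forall k, 0 <= q k) -> (forall k, 0 <= d k) ->
  (forall k, q (S k) <= q k) -> (forall k, d (S k) <= d k - w k * q k) -> Un_cv q 0.
Proof.
  intros w_ge0 w_diverges q_ge0 d_ge0 q_decr d_decr.
  pose proof (fun n => cond_pos_sum w n w_ge0) as sum_ge0.
  assert (sum_le : forall n, q n * sum_f_R0 w n <= d O - d (S n)).
  { intros n. induction n as [|n IH]; simpl.
    - specialize (d_decr O). lra.
    - pose proof (d_decr (S n)).
      pose proof (Rmult_le_compat_r _ _ _ (sum_ge0 n) (q_decr n)). lra. }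
  intros e e_pos. destruct (w_diverges (d O / e)) as [K sum_large]. exists K. intros n n_ge.
  unfold Rdist. rewrite Rminus_0_r, Rabs_right by (apply Rle_ge; auto).
  specialize (sum_large n n_ge). apply (Rmult_lt_compat_l e) in sum_large; [|exact e_pos].
  replace (e * (d O / e)) with (d O) in sum_large by (field; lra).
  apply Rnot_le_lt. intros q_large.
  pose proof (Rmult_le_compat_r _ _ _ (sum_ge0 n) q_large).
  specialize (sum_le n). specialize (d_ge0 (S n)). lra.
Qed.

Section KrasnoselskiiMann.

Context {N : nat}.
Variables (T : vec N -> vec N -> Prop) (tau : nat -> R) (z d : nat -> vec N).
Hypothesis T_firm : firmly_nonexpansive T.
Hypothesis tau_range : forall k, 0 < tau k < 2.
Hypothesis T_zd : forall k, T (z k) (d k).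
Hypothesis z_step : forall k, z (S k) = vsub (z k) (vscal (tau k) (d k)).

Lemma km_weight_ge0 (k : nat) : 0 <= tau k * (2 - tau k).
Proof. specialize (tau_range k). apply Rmult_le_pos; lra. Qed.

Lemma km_fejer_sqr (zf : vec N) (k : nat) : T zf vzero ->
  inner (vsub (z (S k)) zf) (vsub (z (S k)) zf) <=
    inner (vsub (z k) zf) (vsub (z k) zf) - tau k * (2 - tau k) * inner (d k) (d k).
Proof.
  intros T_zf. pose proof (T_firm _ _ _ _ (T_zd k) T_zf) as firm.
  replace (vsub (d k) vzero) with (d k) in firm by vec_ring.
  replace (vsub (z (S k)) zf) with (vsub (vsub (z k) zf) (vscal (tau k) (d k)))
    by (rewrite z_step; vec_ring).
  set (e := vsub (z k) zf) in *. autorewrite with inner. rewrite (inner_comm (d k) e).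
  specialize (tau_range k). nra.
Qed.

Lemma km_fejer (zf : vec N) (k : nat) : T zf vzero ->
  norm (vsub (z (S k)) zf) <= norm (vsub (z k) zf).
Proof.
  intros T_zf. apply norm_le_of_sqr; [apply norm_ge0|]. rewrite norm_sqr.
  pose proof (km_fejer_sqr zf k T_zf).
  pose proof (Rmult_le_pos _ _ (km_weight_ge0 k) (inner_self_ge0 (d k))). lra.
Qed.

Lemma km_residual_decr (k : nat) : inner (d (S k)) (d (S k)) <= inner (d k) (d k).
Proof.
  pose proof (T_firm _ _ _ _ (T_zd (S k)) (T_zd k)) as firm.
  replace (vsub (z (S k)) (z k)) with (vscal (- tau k) (d k)) in firm
    by (rewrite z_step; vec_ring).
  replace (d (S k)) with (vadd (d k) (vsub (d (S k)) (d k))) at 1 2 by vec_ring.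
  set (delta := vsub (d (S k)) (d k)) in *. rewrite inner_vscal_l in firm.
  autorewrite with inner. rewrite (inner_comm delta (d k)).
  pose proof (inner_self_ge0 delta). specialize (tau_range k).
  enough (2 * inner (d k) delta + inner delta delta <= 0) by lra.
  apply (Rmult_le_reg_l (tau k)); nra.
Qed.

Hypothesis tau_diverges : cv_infty (fun n => sum_f_R0 (fun k => tau k * (2 - tau k)) n).

Lemma km_residual_conv0 (zf : vec N) : T zf vzero -> conv d vzero.
Proof.
  intros T_zf. apply conv_of_sqr_cv.
  replace (fun k => inner (vsub (d k) vzero) (vsub (d k) vzero))
    with (fun k => inner (d k) (d k)) by (extensionality k; f_equal; vec_ring).
  apply (weighted_decrease_cv_0 (fun k => tau k * (2 - tau k)) _
    (fun k => inner (vsub (z k) zf) (vsub (z k) zf)));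
    auto using km_weight_ge0, inner_self_ge0, km_residual_decr, km_fejer_sqr.
Qed.

Lemma km_conv : closed_graph T -> (exists zf, T zf vzero) ->
  conv d vzero /\ exists zs, T zs vzero /\ conv z zs.
Proof.
  intros T_closed [zf T_zf]. pose proof (km_residual_conv0 zf T_zf) as d_conv.
  split; [exact d_conv|].
  destruct (bounded_conv_reindexing z (norm (vsub (z O) zf) + norm zf))
    as [zs [phi [phi_ge cluster]]].
  { intros k. eapply Rle_trans; [apply (norm_le_vsub _ zf)|]. apply Rplus_le_compat_r.
    apply (decreasing_prop (fun k => norm (vsub (z k) zf)) 0 k); [|lia].
    intros n. now apply km_fejer. }
  assert (T_zs : T zs vzero).
  { apply (T_closed (fun n => z (phi n)) (fun n => d (phi n)));
      [exact cluster|now apply conv_reindexing|auto]. }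
  exists zs. split; [exact T_zs|]. apply (fejer_cluster_conv z zs phi); [|exact cluster].
  intros k. now apply km_fejer.
Qed.

End KrasnoselskiiMann.

(** * Douglas-Rachford iteration *)

Definition dr_residual {N : nat} (gamma : R) (A B : vec N -> vec N -> Prop)
  (z d : vec N) : Prop :=
  exists x v, resolvent gamma B z x /\ resolvent gamma A (vsub (vscal 2 x) z) v /\
    d = vsub x v.

Section DouglasRachford.

Context {N : nat}.
Variables (gamma : R) (A B : vec N -> vec N -> Prop).
Hypothesis gamma_pos : 0 < gamma.
Hypothesis A_mono : monotone A.
Hypothesis B_mono : monotone B.

Lemma dr_residual_firmly_nonexpansive : firmly_nonexpansive (dr_residual gamma A B).
Proof.
  intros z d z' d' [x [v [x_res [v_res ->]]]] [x' [v' [x'_res [v'_res ->]]]].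
  pose proof (resolvent_firmly_nonexpansive gamma B gamma_pos B_mono _ _ _ _ x_res x'_res)
    as x_firm.
  pose proof (resolvent_firmly_nonexpansive gamma A gamma_pos A_mono _ _ _ _ v_res v'_res)
    as v_firm.
  replace (vsub (vsub (vscal 2 x) z) (vsub (vscal 2 x') z'))
    with (vsub (vscal 2 (vsub x x')) (vsub z z')) in v_firm by vec_ring.
  replace (vsub (vsub x v) (vsub x' v')) with (vsub (vsub x x') (vsub v v')) by vec_ring.
  set (dz := vsub z z') in *. set (dx := vsub x x') in *. set (dv := vsub v v') in *.
  autorewrite with inner in *. rewrite (inner_comm dv dx). lra.
Qed.

Hypothesis A_closed : closed_graph A.
Hypothesis B_closed : closed_graph B.

Lemma dr_resolvents_conv (zk xk vk : nat -> vec N) (z d : vec N) :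
  (forall k, resolvent gamma B (zk k) (xk k)) ->
  (forall k, resolvent gamma A (vsub (vscal 2 (xk k)) (zk k)) (vk k)) ->
  conv zk z -> conv (fun k => vsub (xk k) (vk k)) d ->
  exists x, conv xk x /\ conv vk (vsub x d) /\
    resolvent gamma B z x /\ resolvent gamma A (vsub (vscal 2 x) z) (vsub x d).
Proof.
  intros x_res v_res z_conv d_conv.
  destruct (firmly_nonexpansive_conv (resolvent gamma B) zk xk z) as [x [x_lim x_conv]];
    auto using resolvent_firmly_nonexpansive, resolvent_closed_graph.
  assert (v_conv : conv vk (vsub x d)).
  { replace vk with (fun k => vsub (xk k) (vsub (xk k) (vk k)))
      by (extensionality k; vec_ring).
    now apply conv_vsub. }
  exists x. repeat (split; [assumption|]).
  apply (resolvent_closed_graph gamma A A_closed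
    (fun k => vsub (vscal 2 (xk k)) (zk k)) vk); [|exact v_conv|exact v_res].
  apply conv_vsub; [now apply conv_vscal|exact z_conv].
Qed.

Lemma dr_residual_closed_graph : closed_graph (dr_residual gamma A B).
Proof.
  intros zk dk z d z_conv d_conv dk_res.
  apply choice in dk_res. destruct dk_res as [xk dk_res].
  apply choice in dk_res. destruct dk_res as [vk dk_res].
  destruct (dr_resolvents_conv zk xk vk z d) as [x [_ [_ [x_res v_res]]]].
  - intros k. apply dk_res.
  - intros k. apply dk_res.
  - exact z_conv.
  - replace (fun k => vsub (xk k) (vk k)) with dk; [exact d_conv|].
    extensionality k. apply dk_res.
  - exists x, (vsub x d). repeat (split; [assumption|]). vec_ring.
Qed.

Lemma douglas_rachford_conv (tau : nat -> R) (z x v : nat -> vec N) :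
  (forall k, 0 < tau k < 2) ->
  cv_infty (fun n => sum_f_R0 (fun k => tau k * (2 - tau k)) n) ->
  (forall k, resolvent gamma B (z k) (x k)) ->
  (forall k, resolvent gamma A (vsub (vscal 2 (x k)) (z k)) (v (S k))) ->
  (forall k, z (S k) = vadd (z k) (vscal (tau k) (vsub (v (S k)) (x k)))) ->
  (exists zf, dr_residual gamma A B zf vzero) ->
  exists zs xs, conv z zs /\ conv x xs /\ conv (fun k => v (S k)) xs /\
    resolvent gamma B zs xs /\ resolvent gamma A (vsub (vscal 2 xs) zs) xs.
Proof.
  intros tau_range tau_diverges x_res v_res z_step fixed.
  destruct (km_conv (dr_residual gamma A B) tau z (fun k => vsub (x k) (v (S k))))
    as [d_conv [zs [_ z_conv]]];
    auto using dr_residual_firmly_nonexpansive, dr_residual_closed_graph.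
  - intros k. now exists (x k), (v (S k)).
  - intros k. rewrite z_step. vec_ring.
  - destruct (dr_resolvents_conv z x (fun k => v (S k)) zs vzero) as [xs limits]; auto.
    replace (vsub xs vzero) with xs in limits by vec_ring.
    exists zs, xs. tauto.
Qed.

End DouglasRachford.

Lemma dr_residual_vzero_of_inclusion {N : nat} (gamma : R) (A B : vec N -> vec N -> Prop)
  (x u : vec N) : gamma <> 0 -> B x u -> A x (vopp u) ->
  dr_residual gamma A B (vadd x (vscal gamma u)) vzero.
Proof.
  intros gamma_ne0 B_u A_u. exists x, x. unfold resolvent. split; [|split; [|vec_ring]].
  - replace (vscal (/ gamma) (vsub (vadd x (vscal gamma u)) x)) with u; [exact B_u|].
    vec_ext. now field.
  - replace (vscal (/ gamma) _) with (vopp u); [exact A_u|]. vec_ext. now field.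
Qed.

Theorem theorem5p2 (N : nat) (f g : vec N -> ext) (gamma : R) (tau : nat -> R)
  (z x v : nat -> vec N) :
  proper f -> lsc f -> convex f ->
  proper g -> lsc g -> convex g ->
  (exists y, ri (dom f) y /\ ri (dom g) y) ->
  (exists y, argmin_sum f g y) ->
  0 < gamma ->
  (forall k, 0 < tau k < 2) ->
  cv_infty (fun n => sum_f_R0 (fun k => tau k * (2 - tau k)) n) ->
  is_prox gamma g (z 0%nat) (x 0%nat) ->
  (forall k, is_prox gamma f (vsub (vscal 2 (x k)) (z k)) (v (S k))) ->
  (forall k, z (S k) = vadd (z k) (vscal (tau k) (vsub (v (S k)) (x k)))) ->
  (forall k, is_prox gamma g (z (S k)) (x (S k))) ->
  exists zs xs : vec N,
    conv z zs /\ is_prox gamma g zs xs /\ argmin_sum f g xs /\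
    conv x xs /\ conv v xs /\
    let us := vscal (/ gamma) (vsub zs xs) in
    (forall Sg Sgs, mirror_strat g Sg Sgs ->
       exists K, forall k, (K <= k)%nat ->
         forall M1 M2 M3, stratum Sg xs M1 -> stratum Sg (x k) M2 ->
           stratum Sgs us M3 ->
           strat_le M1 M2 /\ strat_le M2 (J (conjf g) M3)) /\
    (forall Sf Sfs, mirror_strat f Sf Sfs ->
       exists K, forall k, (K <= k)%nat ->
         forall M1 M2 M3, stratum Sf xs M1 -> stratum Sf (v k) M2 ->
           stratum Sfs (vopp us) M3 ->
           strat_le M1 M2 /\ strat_le M2 (J (conjf f) M3)).
Proof.
  intros _ f_lsc f_convex _ g_lsc g_convex qualification [xb xb_min] gamma_pos tau_range
    tau_diverges x0_prox v_prox z_step x_prox.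
  assert (g_res : forall k, resolvent gamma (subdiff g) (z k) (x k))
    by (intros [|k]; now apply prox_resolvent).
  pose proof (fun k => prox_resolvent gamma f _ _ f_convex gamma_pos (v_prox k)) as f_res.
  destruct (argmin_sum_subdiff f g xb f_convex g_convex qualification xb_min) as [u [g_u f_u]].
  destruct (douglas_rachford_conv gamma (subdiff f) (subdiff g) gamma_pos) with tau z x v
    as [zs [xs [z_conv [x_conv [v_conv [xs_res_g xs_res_f]]]]]];
    auto using subdiff_monotone, subdiff_closed_graph.
  { eexists. apply (dr_residual_vzero_of_inclusion gamma _ _ xb u); auto with real. }
  assert (dual_eq : vscal (/ gamma) (vsub (vsub (vscal 2 xs) zs) xs)
                    = vopp (vscal (/ gamma) (vsub zs xs))) by vec_ring.
  exists zs, xs. split; [exact z_conv|]. split; [now apply resolvent_prox|].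
  split; [apply (subdiff_argmin_sum f g xs _ xs_res_g); now rewrite <- dual_eq|].
  split; [exact x_conv|]. split; [now apply conv_shift|]. split.
  - intros Sg Sgs g_mirror. now apply (mirror_strat_resolvent_identification gamma g) with z.
  - intros Sf Sfs f_mirror. rewrite <- dual_eq.
    destruct (mirror_strat_resolvent_identification gamma f Sf Sfs
      (fun k => vsub (vscal 2 (x k)) (z k)) (fun k => v (S k)) (vsub (vscal 2 xs) zs) xs)
      as [K identified]; auto using conv_vsub, conv_vscal.
    exists (S K). intros [|k] k_ge; [lia|]. apply identified. lia.
Qed.
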